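(* Let $\Bbbk$ be an algebraically closed field of characteristic $p\ge0$, let $r\in\mathbb{N}$, and let $V$ be a super vector space over $\Bbbk$ with $\dim V=(m|n)$. Assume $p\notin\{2,3,\dots,r\}$ and $\min(m,n)\ge r$. Then the action of the symmetric group on $V^{\otimes r}$ gives an isomorphism $\Bbbk S_r\stackrel{\sim}{\to}\underline{\mathrm{End}}_{\mathsf{GL}(V)}(V^{\otimes r})$.
   Context: Super spaces are $\mathbb{Z}_2$-graded vector spaces with braiding $\gamma(v\otimes w)=(-1)^{|v||w|}w\otimes v$; $\dim V=(m|n)$ means $\dim V_{\bar0}=m$, $\dim V_{\bar1}=n$. $S_r$ acts on $V^{\otimes r}$ through $\gamma$. $\mathsf{GL}(V)$ is the algebraic super group sending a commutative super algebra $R$ to the group of even $R$-linear automorphisms of $V\otimes R$, represented by a commutative Hopf super algebra $\mathcal{O}$. For a representation (comodule) $M$ with coaction $c_M:M\to M\otimes\mathcal{O}$, $\underline{\mathrm{End}}_{\mathsf{GL}(V)}(M)$ is the space of all linear (not necessarily grading preserving) maps $f:M\to M$ with $(f\otimes\mathrm{id})c_M=c_Mf$. *)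

(* Defs.v *)
From HB Require Import structures.
From mathcomp Require Import all_boot all_order all_algebra all_fingroup.

Set Implicit Arguments.
Unset Strict Implicit.
Unset Printing Implicit Defensive.

Import GRing.Theory.
Local Open Scope ring_scope.

Definition has_characteristic (k : fieldType) (p : nat) : Prop :=
  if p == 0%N then [pchar k] =i pred0 else p \in [pchar k].

(* Finite dimensional super spaces; the parity of an element is a boolean,
   [false] being even and [true] being odd. *)
Record superSpace (k : fieldType) := SuperSpace {
  ss_sort :> vectType k;
  ss_part : bool -> {vspace ss_sort};
  ss_full : (ss_part false + ss_part true = fullv)%VS;
  ss_direct : (ss_part false :&: ss_part true = 0)%VS
}.

Definition sdim (k : fieldType) (V : superSpace k) : nat * nat :=
  (\dim (ss_part V false), \dim (ss_part V true)).

(* Super algebras of arbitrary dimension. The algebras of MathComp are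
   nonzero; the zero algebra is irrelevant below, as a functor represented by a
   super algebra takes a singleton value on it. *)
Record superAlgebra (k : fieldType) := SuperAlgebra {
  sa_sort :> algType k;
  sa_part : bool -> sa_sort -> Prop;
  sa_part0 : forall b, sa_part b 0;
  sa_partP : forall b (c : k) x y,
    sa_part b x -> sa_part b y -> sa_part b (c *: x + y);
  sa_full : forall x, exists x0 x1,
    [/\ sa_part false x0, sa_part true x1 & x = x0 + x1];
  sa_direct : forall x, sa_part false x -> sa_part true x -> x = 0;
  sa_part1 : sa_part false 1;
  sa_partM : forall b c x y,
    sa_part b x -> sa_part c y -> sa_part (b (+) c) (x * y)
}.

Definition supercommutative (k : fieldType) (R : superAlgebra k) : Prop :=
  forall b c (x y : R), sa_part b x -> sa_part c y ->
    x * y = (-1) ^+ (b && c) * (y * x).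

Definition parity_preserving (k : fieldType) (A B : superAlgebra k)
    (phi : A -> B) : Prop :=
  forall b x, sa_part b x -> sa_part b (phi x).

Section HomogeneousBasis.
Variables (k : fieldType) (V : superSpace k).

Definition hdim : nat := (\dim (ss_part V false) + \dim (ss_part V true))%N.

Definition hbasis : hdim.-tuple V :=
  [tuple of vbasis (ss_part V false) ++ vbasis (ss_part V true)].

Definition hvec (i : 'I_hdim) : V := tnth hbasis i.

Definition hpar (i : 'I_hdim) : bool := (\dim (ss_part V false) <= i)%N.

Lemma hbasisP : basis_of fullv hbasis.
Proof.
rewrite basisEdim -{1}(ss_full V) /= span_cat.
have /andP [/eqP-> _] := vbasisP (ss_part V false).
have /andP [/eqP-> _] := vbasisP (ss_part V true).
rewrite subvv /= size_tuple -(ss_full V) /hdim.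
have := dimv_sum_cap (ss_part V false) (ss_part V true).
by rewrite ss_direct dimv0 addn0 => ->.
Qed.

Lemma hvec_part i : hvec i \in ss_part V (hpar i).
Proof.
rewrite /hvec (tnth_nth 0) /= nth_cat size_tuple /hpar ltnNge.
case: leqP => /= h.
  by apply/vbasis_mem/mem_nth; rewrite size_tuple ltn_subLR.
by apply/vbasis_mem/mem_nth; rewrite size_tuple.
Qed.

Lemma hcoord_homog b (v : V) i :
  v \in ss_part V b -> hpar i != b -> coord hbasis i v = 0.
Proof.
have fr := basis_free hbasisP.
have szl : size (vbasis (ss_part V false)) = \dim (ss_part V false).
  by rewrite size_tuple.
move=> vb hi.
suff [c [-> c0]] : exists c : 'I_hdim -> k,
    v = \sum_j c j *: hbasis`_j /\ (forall j, hpar j != b -> c j = 0).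
  by rewrite coord_sum_free // c0.
case: b vb hi => vb _.
- exists (fun j : 'I_hdim => match split j with inl _ => 0
          | inr a => coord (vbasis (ss_part V true)) a v end).
  split; last first.
    move=> j; rewrite /hpar; case: splitP => // a -> .
    by rewrite leq_addr.
  rewrite big_split_ord /= [X in X + _]big1 ?add0r; last first.
    move=> a _; case: splitP => [a' _|a' /= h]; first by rewrite scale0r.
    by have := ltn_ord a; rewrite h ltnNge leq_addr.
  rewrite {1}(coord_vbasis vb); apply: eq_bigr => a _.
  case: splitP => [a' /= h|a' /= /addnI h].
    by have := ltn_ord a'; rewrite -h ltnNge leq_addr.
  rewrite nth_cat szl ltnNge leq_addr /= addKn.
  by rewrite (_ : a' = a) //; apply: val_inj.
- exists (fun j : 'I_hdim => match split j with
          | inl a => coord (vbasis (ss_part V false)) a v | inr _ => 0 end).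
  split; last first.
    move=> j; rewrite /hpar; case: splitP => // a ->.
    by rewrite leqNgt ltn_ord.
  rewrite big_split_ord /= [X in _ + X]big1 ?addr0; last first.
    move=> a _; case: splitP => [a' /= h|a' _]; last by rewrite scale0r.
    by have := ltn_ord a'; rewrite -h ltnNge leq_addr.
  rewrite {1}(coord_vbasis vb); apply: eq_bigr => a _.
  case: splitP => [a' /= h|a' /= h].
    rewrite nth_cat szl ltn_ord.
    by rewrite (_ : a' = a) //; apply: val_inj.
  by have := ltn_ord a; rewrite h ltnNge leq_addr.
Qed.

End HomogeneousBasis.

Section GeneralLinearSuperGroup.
Variables (k : fieldType) (V : superSpace k).

(* V (x) R, an element x standing for \sum_i hvec i (x) x i. *)
Definition scalext (R : superAlgebra k) := {ffun 'I_(hdim V) -> R}.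

Definition ptens (R : superAlgebra k) (v : V) (a : R) : scalext R :=
  [ffun i => coord (hbasis V) i v *: a].

Definition scalext_mulr (R : superAlgebra k) (x : scalext R) (a : R) :
  scalext R := [ffun i => x i * a].

Definition scalext_part (R : superAlgebra k) (b : bool) (x : scalext R) :=
  forall i, sa_part (b (+) hpar i) (x i).

Definition scalext_map (R S : superAlgebra k) (phi : R -> S) (x : scalext R) :
  scalext S := [ffun i => phi (x i)].

Definition in_GL (R : superAlgebra k) (g : scalext R -> scalext R) : Prop :=
  [/\ forall x y, g (x + y) = g x + g y,
      forall x a, g (scalext_mulr x a) = scalext_mulr (g x) a,
      forall b x, scalext_part b x -> scalext_part b (g x)
    & bijective g].

(* O represents the functor GL(V) on commutative super algebras, with
   universal element u in GL(V)(O): every g in GL(V)(R) is the image of u under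
   GL(V)(phi) for a unique morphism phi : O -> R. By R-linearity, that image is
   determined by its values (id (x) phi) (u (v (x) 1)) on the v (x) 1. The Hopf
   structure of O is the group structure of GL(V)(R) = Hom(O, R). *)
Definition represents_GL (O : superAlgebra k) (u : scalext O -> scalext O) :
    Prop :=
  [/\ supercommutative O, in_GL u &
    forall (R : superAlgebra k) (g : scalext R -> scalext R),
      supercommutative R -> in_GL g ->
      let induces (phi : O -> R) :=
        forall v : V, g (ptens v 1) = scalext_map phi (u (ptens v 1)) in
      exists phi : {lrmorphism O -> R},
        [/\ parity_preserving phi, induces phi &
          forall psi : {lrmorphism O -> R},
            parity_preserving psi -> induces psi -> psi =1 phi]].

(* The coaction V -> V (x) O of the tautological representation. *)
Definition taut_coaction (O : superAlgebra k) (u : scalext O -> scalext O)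
  (v : V) : scalext O := u (ptens v 1).

End GeneralLinearSuperGroup.

Section TensorPower.
Variables (k : fieldType) (V : superSpace k) (r : nat).

Definition mindex := {ffun 'I_r -> 'I_(hdim V)}.

(* The tensor power V^{(x) r}, an element t standing for
   \sum_j t j *: hvec (j 0) (x) ... (x) hvec (j (r - 1)). *)
Definition tpower : vectType k := {ffun mindex -> k^o}.

Definition tpure (v : 'I_r -> V) : tpower :=
  [ffun j : mindex => \prod_(a < r) coord (hbasis V) (j a) (v a)].

Definition tbasis (j : mindex) : tpower := tpure (fun a => hvec (j a)).

Lemma tbasisE (i j : mindex) : tbasis j i = (i == j)%:R.
Proof.
have fr := basis_free (hbasisP V).
have e (a b : 'I_(hdim V)) : coord (hbasis V) a (hvec b) = (a == b)%:R.
  by rewrite /hvec (tnth_nth 0) coord_free // eq_sym.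
rewrite ffunE; case: eqP => [->|/eqP ne].
  by rewrite big1 // => a _; rewrite e eqxx.
have [a na] : exists a, i a != j a.
  apply/existsP; rewrite -negb_forall; apply: contra ne => /forallP h.
  by apply/eqP/ffunP => a; apply/eqP.
by rewrite (bigD1 a) //= e (negbTE na) mul0r.
Qed.

(* Number of pairs of odd factors that are exchanged when the r factors, of
   parities q, are permuted by s. *)
Definition odd_crossings (s : 'S_r) (q : 'I_r -> bool) : nat :=
  \sum_(a < r) \sum_(b < r | (a < b)%N && (s b < s a)%N) (q a && q b).

(* s moves the factor in position a to position s a, each exchange of two
   factors being the braiding gamma. *)
Definition perm_act (s : 'S_r) (t : tpower) : tpower :=
  \sum_(j : mindex) t j *:
    ((-1) ^+ odd_crossings s (fun a => hpar (j a)) *: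
       tpure (fun a => hvec (j ((s^-1)%g a)))).

Lemma perm_act_linear s : linear (perm_act s).
Proof.
move=> c x y; rewrite /perm_act scaler_sumr -big_split /=.
by apply: eq_bigr => j _; rewrite [in RHS]scalerA -scalerDl; congr (_ *: _); rewrite !ffunE.
Qed.

HB.instance Definition _ s := GRing.isLinear.Build k tpower tpower _
  (perm_act s) (perm_act_linear s).

Lemma perm_act_coef s (t : tpower) (i : mindex) :
  perm_act s t i =
  (-1) ^+ odd_crossings s (fun a => hpar (i (s a))) * t [ffun a => i (s a)].
Proof.
rewrite /perm_act sum_ffunE (bigD1 [ffun a => i (s a)]) //= big1 ?addr0.
  rewrite !ffunE /= big1 => [|a _]; last first.
    have := tbasisE i i; rewrite eqxx ffunE ffunE permKV /hvec.
    by rewrite (tnth_nth 0) (coord_free _ _ (basis_free (hbasisP V))) eqxx.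
  rewrite /GRing.scale /= mulr1 mulrC; congr (_ ^+ _ * _).
  by apply: eq_bigr => a _; apply: eq_bigr => b _; rewrite !ffunE.
move=> j nj; have := tbasisE i [ffun a => j ((s^-1)%g a)].
have -> : tbasis [ffun a => j ((s^-1)%g a)] =
          tpure (fun a => hvec (j ((s^-1)%g a))).
  by apply/ffunP => x; rewrite !ffunE; apply: eq_bigr => a _; rewrite ffunE.
rewrite !ffunE => ->; case: eqP => [h|_]; last by rewrite /GRing.scale /= !mulr0.
case/eqP: nj; apply/ffunP => a.
by rewrite ffunE h ffunE permK.
Qed.

(* The action is the expected one on all homogeneous pure tensors. *)
Lemma perm_act_pure s (v : 'I_r -> V) (q : 'I_r -> bool) :
  (forall a, v a \in ss_part V (q a)) ->
  perm_act s (tpure v) =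
  (-1) ^+ odd_crossings s q *: tpure (fun a => v ((s^-1)%g a)).
Proof.
move=> vq; apply/ffunP => i; rewrite perm_act_coef !ffunE.
rewrite [in RHS](reindex_inj (@perm_inj _ s)) /=.
under eq_bigr do rewrite ffunE.
under [in RHS]eq_bigr do rewrite permK.
have [/forallP h|] := boolP [forall a, hpar (i (s a)) == q a].
  rewrite /GRing.scale /=; congr (_ ^+ _ * _); apply: eq_bigr => a _.
  by apply: eq_bigr => b _; rewrite !(eqP (h _)).
rewrite negb_forall => /existsP [a na].
by rewrite (bigD1 a) //= (hcoord_homog (vq a) na) mul0r mulr0 scaler0.
Qed.

(* V^{(x) r} (x) O, with the same convention as for the tensor power. *)
Definition tpower_ext (O : superAlgebra k) := {ffun mindex -> O}.

(* The tensor product of r copies of the tautological comodule: the element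
   \sum_i X i (j a) of O collects the coefficient of hvec (i a) in the coaction
   on hvec (j a), and moving this coefficient, of parity |i a| + |j a|, to the
   right of the factors hvec (i b), a < b, produces the sign. *)
Definition coaction_sign (i j : mindex) : nat :=
  \sum_(a < r) \sum_(b < r | (a < b)%N)
    ((hpar (i a) (+) hpar (j a)) && hpar (i b)).

Definition tpower_coaction (O : superAlgebra k) (u : scalext V O -> scalext V O)
    (t : tpower) : tpower_ext O :=
  [ffun i : mindex => \sum_(j : mindex) t j *:
     ((-1) ^+ coaction_sign i j *
        \prod_(a < r) taut_coaction u (hvec (j a)) (i a))].

(* f (x) id_O *)
Definition tpower_map_ext (O : superAlgebra k) (f : 'End(tpower))
    (x : tpower_ext O) : tpower_ext O :=
  [ffun i : mindex => \sum_(j : mindex) f (tbasis j) i *: x j].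

Definition comodule_end (O : superAlgebra k) (u : scalext V O -> scalext V O)
    (f : 'End(tpower)) : Prop :=
  forall t, tpower_map_ext f (tpower_coaction u t) = tpower_coaction u (f t).

End TensorPower.

Section GroupAlgebra.
Variables (k : fieldType) (r : nat).

Definition symalg := {ffun 'S_r -> k^o}.

Definition symalg_one : symalg := [ffun s => (s == 1%g)%:R].

(* The product in 'S_r is composition in the diagrammatic order, whence
   [(t * s)%g] for the permutation a |-> s (t a). *)
Definition symalg_mul (x y : symalg) : symalg :=
  [ffun w => \sum_(s : 'S_r) \sum_(t : 'S_r | (t * s)%g == w) x s * y t].

Definition symalg_act (V : superSpace k) (x : symalg) : 'End(tpower V r) :=
  \sum_(s : 'S_r) x s *: linfun (perm_act (V := V) s).

End GroupAlgebra.

(* Main.v *)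
(* Let e be a basis tensor v_1 (x) ... (x) v_r of V^{(x) r} with distinct even
   factors; it exists as r <= m. Over the dual numbers k[eps], where eps is
   given the parity |b| + |c|, the map 1 + eps E_bc is a point of GL(V). Hence
   an endomorphism f of the comodule commutes with the operator by which E_bc
   acts on V^{(x) r} as a derivation.
   For b = c in e this shows that f e is a combination of the permutations of e,
   so that f e = x e for some x in k S_r. The map f - x then kills e, and it
   vanishes since e generates V^{(x) r} under the operators E_bc: the factors of
   e are replaced one after the other by arbitrary basis vectors, the unwanted
   terms of the derivation being tensors that were reached before.
   Conversely, S_r commutes with the coaction by a computation of signs. *)
Require Import Defs.
From HB Require Import structures.
From mathcomp Require Import all_boot all_order all_algebra all_fingroup.
From mathcomp Require Import zify.

Set Implicit Arguments.
Unset Strict Implicit.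
Unset Printing Implicit Defensive.

Import GRing.Theory.
Local Open Scope ring_scope.

(** * Dual numbers *)

(** A pair (x, y) stands for x + y eps. The separate name keeps the componentwise product of pairs
    of rings away. *)
Definition dual (k : fieldType) : Type := (k^o * k^o)%type.

Section DualNumbers.
Variable k : fieldType.

HB.instance Definition _ := GRing.Lmodule.on (dual k).

Definition dual_one : dual k := (1, 0).
Definition dual_mul (x y : dual k) : dual k :=
  (x.1 * y.1, x.1 * y.2 + x.2 * y.1).

Lemma dual_mulA : associative dual_mul.
Proof.
move=> x y z; rewrite /dual_mul /= !mulrDr !mulrDl !mulrA.
by rewrite addrA.
Qed.

Lemma dual_mulC : commutative dual_mul.
Proof.
move=> x y; rewrite /dual_mul /= mulrC; congr (_, _).
by rewrite addrC; congr (_ + _); rewrite mulrC.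
Qed.

Lemma dual_mul1 : left_id dual_one dual_mul.
Proof. by case=> x y; rewrite /dual_mul /= !mul1r mul0r addr0. Qed.

Lemma dual_mulDl : left_distributive dual_mul +%R.
Proof.
move=> x y z; rewrite /dual_mul /= !mulrDl; congr (_, _).
by rewrite addrACA.
Qed.

Lemma dual_one_neq0 : dual_one != 0.
Proof. by apply/eqP => -[/eqP]; rewrite oner_eq0. Qed.

HB.instance Definition _ := GRing.Zmodule_isComNzRing.Build (dual k)
  dual_mulA dual_mulC dual_mul1 dual_mulDl dual_one_neq0.

Lemma dual_ext (x y : dual k) : x.1 = y.1 -> x.2 = y.2 -> x = y.
Proof. by case: x y => [? ?] [? ?] /= -> ->. Qed.

Lemma dual_scaleAl (a : k) (x y : dual k) :
  a *: dual_mul x y = dual_mul (a *: x) y.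
Proof.
apply: dual_ext; rewrite /= /GRing.scale /= ?mulrA //.
by rewrite mulrDr !mulrA.
Qed.

HB.instance Definition _ :=
  GRing.Lmodule_isLalgebra.Build k (dual k) dual_scaleAl.
HB.instance Definition _ := GRing.Lalgebra_isComAlgebra.Build k (dual k).

Lemma dual_mulE1 (x y : dual k) : (x * y).1 = x.1 * y.1.
Proof. by []. Qed.

Lemma dual_mulE2 (x y : dual k) : (x * y).2 = x.1 * y.2 + x.2 * y.1.
Proof. by []. Qed.

Definition eps : dual k := (0, 1).

Lemma eps_sqr : eps * eps = 0.
Proof.
by apply: dual_ext; rewrite ?dual_mulE1 ?dual_mulE2 /= ?mul0r ?mulr0 ?addr0.
Qed.

(* The grading in which eps has parity q. *)
Definition dual_part (q b : bool) (x : dual k) : Prop :=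
  (b -> x.1 = 0) /\ (b != q -> x.2 = 0).

Definition dual_super (q : bool) : superAlgebra k.
Proof.
apply: (@SuperAlgebra k (dual k) (dual_part q)).
- by [].
- move=> b c x y [x1 x2] [y1 y2]; split=> h /=.
    by rewrite x1 ?y1 ?addr0 ?scaler0.
  by rewrite x2 ?y2 ?addr0 ?scaler0.
- move=> [x0 x1].
  exists ((x0, if q then 0 else x1) : dual k).
  exists ((0, if q then x1 else 0) : dual k).
  split; rewrite /dual_part; try by case: q.
  by case: q; apply: dual_ext; rewrite /= ?addr0 ?add0r.
- move=> x [_ h0] [h1 h2]; apply: dual_ext; first exact: h1.
  by case: q h0 h2 => /= h0 h2; [apply: h0 | apply: h2].
- by [].
- move=> b c x y [hx0 hx1] [hy0 hy1]; split.
    rewrite dual_mulE1; case: b hx0 {hx1} => [->|_] // => [|hc].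
      by rewrite mul0r.
    by rewrite hy0 ?mulr0.
  move=> h; rewrite dual_mulE2; move: hx0 hx1 hy0 hy1.
  by case: b h; case: c; case: q => //= _ hx0 hx1 hy0 hy1;
    do ?[rewrite (hx0 isT)]; do ?[rewrite (hx1 isT)]; do ?[rewrite (hy0 isT)];
    do ?[rewrite (hy1 isT)]; rewrite ?mulr0 ?mul0r ?addr0.
Defined.

(** The underlying ring is commutative, so only two odd factors matter. Their constant terms vanish,
    and multiples of [eps] multiply to zero. *)
Lemma dual_supercommutative q : supercommutative (dual_super q).
Proof.
move=> b c x y; have [|_ _ _] := boolP (b && c); last first.
  by rewrite expr0 mul1r [LHS](@mulrC (dual k)).
have M0 (x' y' : dual k) : x'.1 = 0 -> y'.1 = 0 -> x' * y' = 0.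
  move=> hx hy; apply: dual_ext; rewrite ?dual_mulE1 ?dual_mulE2 hx hy.
    by rewrite mul0r.
  by rewrite mul0r mulr0 addr0.
case/andP => -> -> [hx _] [hy _].
have -> : x * y = 0 := M0 _ _ (hx isT) (hy isT).
have -> : y * x = 0 := M0 _ _ (hy isT) (hx isT).
by rewrite mulr0.
Qed.

Lemma eps_part q : sa_part (s := dual_super q) q eps.
Proof. by split=> //=; rewrite eqxx. Qed.

Lemma dual_prod1 (I : Type) (l : seq I) (P : pred I) (x : I -> dual k) :
  (\prod_(a <- l | P a) x a).1 = \prod_(a <- l | P a) (x a).1.
Proof. by elim/big_ind2: _ => // x1 x2 y1 y2 <- <-. Qed.

(** The Leibniz rule; it makes E_bc act on the tensor power as a derivation. *)
Lemma dual_prod2 (I : finType) (x : I -> dual k) :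
  (\prod_a x a).2 = \sum_a (x a).2 * \prod_(b | b != a) (x b).1.
Proof.
elim: (index_enum I) (index_enum_uniq I) => [|a l IH] /= => [_|/andP [al ul]].
  by rewrite !big_nil.
rewrite !big_cons dual_mulE2 eqxx IH //= addrC dual_prod1; congr (_ * _ + _).
  rewrite [RHS]big_seq_cond; rewrite [LHS]big_seq; apply: eq_bigl => b.
  by case: eqP => [->|]; rewrite ?(negbTE al) ?andbT.
rewrite mulr_sumr big_seq [RHS]big_seq; apply: eq_bigr => b bl.
rewrite big_cons ifT; last by apply: contraNneq al => ->.
by rewrite mulrCA.
Qed.
End DualNumbers.

(** * Signs of permutations of odd factors *)

Section Pairs.
Variable r : nat.

(** Signs are compared through their exponents mod 2, so that an identity of signs reduces to a case
    check on each pair of positions. *)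
Definition pairs_sum (F : 'I_r -> 'I_r -> bool) : bool :=
  \big[addb/false]_(a < r) \big[addb/false]_(b < r | (a < b)%N) F a b.

Lemma pairs_reindex (s : 'S_r) (F : 'I_r -> 'I_r -> bool) :
  pairs_sum (fun a b => F (s a) (s b)) =
  pairs_sum (fun a b =>
    if ((s^-1)%g a < (s^-1)%g b)%N then F a b else F b a).
Proof.
pose lt a b := ((s^-1)%g a < (s^-1)%g b)%N.
(* The right side splits into the pairs whose order [s^-1] keeps and those it reverses. Exchanging
   the variables in the second sum merges both into all (a, b) with [lt a b], which is the left side
   reindexed by [s]. *)
transitivity (\big[addb/false]_(a < r) \big[addb/false]_(b < r)
    ((a < b)%N && (lt a b && F a b)) (+)
  \big[addb/false]_(a < r) \big[addb/false]_(b < r)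
    ((a < b)%N && (lt b a && F b a))).
  rewrite [X in _ (+) X]exchange_big -big_split /= /pairs_sum.
  rewrite [RHS](reindex_inj (@perm_inj _ s)) /=; apply: eq_bigr => a _.
  rewrite -big_split [RHS](reindex_inj (@perm_inj _ s)) /= [LHS]big_mkcond.
  apply: eq_bigr => b _; rewrite /lt !permK.
  case: (ltnP a b) => [ab|]; last by rewrite !andbF.
  rewrite /= -andb_addl; case: ltngtP => // /val_inj/perm_inj e.
  by rewrite e ltnn in ab.
rewrite -big_split; apply: eq_bigr => a _; rewrite -big_split /=.
rewrite [RHS]big_mkcond; apply: eq_bigr => b _ /=.
case: (ltnP a b) => // ab; rewrite /lt.
case: ltngtP => /=; rewrite ?addbF //.
by move=> /val_inj/perm_inj e; rewrite e ltnn in ab.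
Qed.

Lemma pairs_sumD F G :
  pairs_sum (fun a b => F a b (+) G a b) = pairs_sum F (+) pairs_sum G.
Proof.
rewrite /pairs_sum -big_split; apply: eq_bigr => a _; exact: big_split.
Qed.

Lemma eq_pairs_sum F G :
  (forall a b : 'I_r, (a < b)%N -> F a b = G a b) -> pairs_sum F = pairs_sum G.
Proof. by move=> FG; do 2!apply: eq_bigr => ? ?; apply: FG. Qed.

Lemma odd_pairs (F : 'I_r -> 'I_r -> nat) :
  odd (\sum_(a < r) \sum_(b < r | (a < b)%N) F a b) =
  pairs_sum (fun a b => odd (F a b)).
Proof.
rewrite (big_morph odd oddD (erefl _)); apply: eq_bigr => a _.
by rewrite (big_morph odd oddD (erefl _)).
Qed.

Lemma odd_crossingsE (s : 'S_r) q :
  odd (odd_crossings s q) =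
  pairs_sum (fun a b => (s b < s a)%N && (q a && q b)).
Proof.
rewrite /odd_crossings; under eq_bigr do rewrite big_mkcondr.
by rewrite odd_pairs; apply: eq_pairs_sum => a b _; case: ifP; rewrite ?oddb.
Qed.

Lemma odd_crossings1 q : odd (odd_crossings (1%g : 'S_r) q) = false.
Proof.
rewrite odd_crossingsE /pairs_sum big1 // => a _; rewrite big1 // => b ab.
by rewrite !perm1 ltnNge ltnW.
Qed.

(** The composite inverts a pair exactly when one, but not both, of its two stages does. The second
    stage sees the parities as [t] has moved them. *)
Lemma odd_crossingsM (s t : 'S_r) q :
  odd (odd_crossings (t * s)%g q) =
  odd (odd_crossings t q) (+) odd (odd_crossings s (fun a => q ((t^-1)%g a))).
Proof.
rewrite !odd_crossingsE.
pose F a b := (s (t b) < s (t a))%N && (q a && q b).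
rewrite [X in _ (+) X](eq_pairs_sum (G :=
    fun a b => F ((t^-1)%g a) ((t^-1)%g b))); last first.
  by move=> a b _; rewrite /F !permKV.
rewrite (pairs_reindex t^-1 F) -pairs_sumD; apply: eq_pairs_sum => a b ab.
rewrite /F !permM invgK /=.
have gtE (c d : 'I_r) : c != d -> (d < c)%N = ~~ (c < d)%N.
  move=> cd; rewrite -leqNgt [RHS]leq_eqVlt (inj_eq val_inj).
  by rewrite eq_sym (negbTE cd).
have ne : a != b by apply: contraTneq ab => ->; rewrite ltnn.
rewrite (gtE (t a)) ?(inj_eq perm_inj) // (gtE (s (t a))) ?(inj_eq perm_inj) //.
case: (_ < _)%N; case: (_ < _)%N; case: (q a); case: (q b) => //.
Qed.

(** Reduces sign rules to one exchange of neighbours. Transpositions generate, and one at distance n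
    + 2 is conjugate, by an adjacent one, to one at distance n + 1. *)
Lemma perm_adjacent_ind (P : 'S_r -> Prop) :
  P 1%g -> (forall s t, P s -> P t -> P (t * s)%g) ->
  (forall a b : 'I_r, b = a.+1 :> nat -> P (tperm a b)) -> forall s, P s.
Proof.
move=> P1 PM Padj.
have Plt n (a b : 'I_r) : (b = a + n.+1 :> nat)%N -> P (tperm a b).
  elim: n b => [|n IH] b ab; first by apply: Padj; rewrite ab addn1.
  have lc : (a + n.+1 < r)%N.
    by apply: leq_ltn_trans (ltn_ord b); rewrite ab leq_add2l.
  pose c := Ordinal lc.
  have bc : b = c.+1 :> nat by rewrite ab addnS.
  have -> : tperm a b = (tperm c b * (tperm a c * tperm c b))%g.
    rewrite -[X in (X * _)%g]tpermV -/(conjg _ _) tpermJ tpermL tpermD //.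
      by rewrite -(inj_eq val_inj) /= -{2}[val a]addn0 eqn_add2l.
    by rewrite -(inj_eq val_inj) /= ab -{2}[val a]addn0 eqn_add2l.
  by apply: (PM); [apply: (PM); [apply: (Padj)|apply: (IH)]|apply: (Padj)].
move=> s; have [l -> _] := prod_tpermP s.
elim: l => [|[a b] l IH]; first by rewrite big_nil.
rewrite big_cons /=; apply: PM => //.
case: (ltngtP a b) => [ab|ba|/val_inj->].
- by apply: (Plt (b - a).-1); rewrite prednK ?subn_gt0 // subnKC // ltnW.
- by rewrite tpermC; apply: (Plt (a - b).-1);
    rewrite prednK ?subn_gt0 // subnKC // ltnW.
- by rewrite tperm1.
Qed.

(** The exchange of two neighbours inverts no pair but theirs. *)
Lemma odd_crossings_adjacent (a b : 'I_r) q : b = a.+1 :> nat ->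
  odd (odd_crossings (tperm a b) q) = q a && q b.
Proof.
move=> ab; have lt_ab : (a < b)%N by rewrite ab.
have tE (c d : 'I_r) : (c < d)%N ->
    (tperm a b d < tperm a b c)%N = (c == a) && (d == b).
  move=> cd; apply/idP/andP => [|[/eqP -> /eqP ->]]; last first.
    by rewrite tpermL tpermR.
  case: tpermP => [dE|dE|da db]; case: tpermP => [cE|cE|ca cb];
    rewrite ?dE ?cE ?eqxx // in cd *; rewrite ?ltnn // in cd *;
    move=> dc; exfalso; lia.
rewrite odd_crossingsE /pairs_sum (bigD1 a) //= (bigD1 b) //= tE // !eqxx /=.
rewrite !big1 ?addbF //.
  move=> c ca; rewrite big1 // => d cd; by rewrite tE // (negbTE ca).
by move=> c /andP [ac cb]; rewrite tE // (negbTE cb) andbF.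
Qed.

End Pairs.


(** By induction over adjacent transpositions: exchanging two neighbours costs the sign of
    supercommutativity, and signs compose by [odd_crossingsM]. *)
Lemma supercommutative_prod_perm (k : fieldType) (O : superAlgebra k) r
    (y : 'I_r -> O) (q : 'I_r -> bool) (s : 'S_r) :
  supercommutative O -> (forall a, sa_part (q a) (y a)) ->
  \prod_a y ((s^-1)%g a) = (-1) ^+ odd_crossings s q * \prod_a y a.
Proof.
move=> OC; elim/perm_adjacent_ind: s y q => [|s t Ps Pt|a b ab] y q yq.
- rewrite -signr_odd odd_crossings1 mul1r.
  by apply: eq_bigr => a _; rewrite invg1 perm1.
- rewrite -signr_odd odd_crossingsM addbC signr_addb !signr_odd.
  under eq_bigr do rewrite invMg permM.
  rewrite (Ps (fun a => y ((t^-1)%g a)) (fun a => q ((t^-1)%g a))) //.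
  rewrite (Pt y q) //.
  by rewrite mulrA.
- have lt_ab : (a < b)%N by rewrite ab.
  (* Cuts the product around the neighbours [a] and [b]. All numbers [c] that occur are below [r],
     so the default of [insubd] is never taken. *)
  have toN (z : 'I_r -> O) : \prod_c z c = \prod_(0 <= c < a) z (insubd a c) *
      (z a * (z b * \prod_(b.+1 <= c < r) z (insubd a c))).
    transitivity (\prod_(0 <= c < r) z (insubd a c)).
      by rewrite big_mkord; apply: eq_bigr => c _; rewrite valKd.
    rewrite (big_cat_nat (n := a)) //=; last exact/ltnW/ltn_ord.
    by rewrite (big_ltn (ltn_ord a)) -ab (big_ltn (ltn_ord b)) !valKd.
  rewrite -signr_odd odd_crossings_adjacent // !toN !tpermV tpermL tpermR.
  have fix_ab c : (c < r)%N -> c != a -> c != b ->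
      y (tperm a b (insubd a c)) = y (insubd a c).
    move=> cr ca cb; rewrite tpermD // -(inj_eq val_inj) /=;
      by rewrite val_insubd cr eq_sym.
  rewrite [in LHS](eq_big_nat _ _ (F2 := fun c => y (insubd a c))); last first.
    move=> c /andP [_ ca]; apply: fix_ab; [|lia|lia].
    exact: ltn_trans ca (ltn_ord a).
  rewrite [X in _ * (_ * (_ * X)) = _](eq_big_nat _ _
     (F2 := fun c => y (insubd a c))); last first.
    by move=> c /andP [bc cr]; apply: fix_ab; lia.
  rewrite !mulrA; congr (_ * _); rewrite -!mulrA (OC _ _ _ _ (yq b) (yq a)).
  by rewrite [LHS]mulrA commr_sign -mulrA andbC.
Qed.

(** * The operators E_bc on the tensor power *)

Lemma coord_hvec (k : fieldType) (V : superSpace k) (i j : 'I_(hdim V)) :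
  coord (hbasis V) i (hvec j) = (i == j)%:R.
Proof.
by rewrite /hvec (tnth_nth 0) coord_free ?(basis_free (hbasisP V)) // eq_sym.
Qed.

Section Elementary.
Variables (k : fieldType) (V : superSpace k) (b c : 'I_(hdim V)).

Notation R := (dual_super k (hpar b (+) hpar c)).
Let e : R := eps k.

(* The map 1 + eps E_bc. *)
Definition elementary (x : scalext V R) : scalext V R :=
  [ffun i => x i + (i == b)%:R *: (e * x c)].

(** The map is even because [eps] has the parity of E_bc; its inverse is 1 - eps E_bc because eps^2
    = 0. *)
Lemma elementary_GL : in_GL elementary.
Proof.
have ee : e * e = 0 := eps_sqr k.
split.
- move=> x y; apply/ffunP => i; rewrite !ffunE mulrDr scalerDr addrACA //.
- move=> x a; apply/ffunP => i; rewrite !ffunE mulrDl -scalerAl mulrA //.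
- move=> q x xq i; rewrite ffunE; have [->|_] := eqVneq i b; last first.
    by rewrite scale0r addr0.
  rewrite addrC; apply: sa_partP; last exact: xq.
  have -> : q (+) hpar b = hpar b (+) hpar c (+) (q (+) hpar c).
    by case: (hpar b); case: (hpar c); case: q {xq}.
  by apply: sa_partM; [apply: eps_part|apply: xq].
- pose h (x : scalext V R) : scalext V R :=
    [ffun i => x i - (i == b)%:R *: (e * x c)].
  apply: (@Bijective _ _ elementary h).
    move=> x; apply/ffunP => i; rewrite !ffunE mulrDr -scalerAr mulrA ee mul0r.
    by rewrite scaler0 addr0 addrK.
  move=> x; apply/ffunP => i; rewrite !ffunE mulrBr -scalerAr mulrA ee mul0r.
  by rewrite scaler0 subr0 subrK.
Qed.

Lemma elementary_hvec (i j : 'I_(hdim V)) :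
  elementary (ptens (hvec j) (1 : R)) i =
    ((i == j)%:R, ((i == b) && (j == c))%:R) :> dual k.
Proof.
rewrite !ffunE !coord_hvec (eq_sym c); apply: dual_ext.
  by rewrite /= mul0r scaler0 addr0 /GRing.scale /= mulr1.
have eE (z : R) : (e * z : dual k).2 = (z : dual k).1.
  by rewrite (dual_mulE2 e z) /= mul0r add0r mul1r.
pose s : R := (i == j)%:R *: 1; pose t : R := (j == c)%:R *: 1.
rewrite -[LHS]/((s : dual k).2 + (i == b)%:R * (e * t : dual k).2) eE.
by rewrite /= /GRing.scale /= mulr0 add0r mulr1 -natrM mulnb.
Qed.

End Elementary.

(** * From points over the dual numbers to commutation with E_bc *)

Section Commutation.
Variables (k : fieldType) (V : superSpace k) (r : nat).
Notation mindex := (mindex V r).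

Lemma tpower_sum (t : tpower V r) : t = \sum_(j : mindex) t j *: tbasis j.
Proof.
apply/ffunP => i; rewrite sum_ffunE (bigD1 i) //= big1 ?addr0.
  by rewrite ffunE tbasisE eqxx /GRing.scale /= mulr1.
move=> j ji; rewrite ffunE tbasisE eq_sym (negbTE ji).
by rewrite /GRing.scale /= mulr0.
Qed.

(* The coefficient of eps in the entry (i, j) of 1 + eps E_bc acting on the
   tensor power. *)
Definition deriv_coef (b c : 'I_(hdim V)) (i j : mindex) : k :=
  (-1) ^+ coaction_sign i j *
  \sum_(a < r) ((i a == b) && (j a == c))%:R *
    \prod_(a' < r | a' != a) (i a' == j a')%:R.

Definition coaction_coef (O : superAlgebra k) (u : scalext V O -> scalext V O)
    (i j : mindex) : O :=
  (-1) ^+ coaction_sign i j * \prod_(a < r) taut_coaction u (hvec (j a)) (i a).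

Lemma tpower_coaction_tbasis (O : superAlgebra k)
    (u : scalext V O -> scalext V O) (i l : mindex) :
  tpower_coaction u (tbasis l) i = coaction_coef u i l.
Proof.
rewrite ffunE (bigD1 l) //= [X in _ + X]big1 ?addr0 => [|j jl].
  by rewrite tbasisE eqxx scale1r.
by rewrite tbasisE (negbTE jl) scale0r.
Qed.

(** The universal property turns 1 + eps E_bc into a morphism [phi] from [O] to the dual numbers.
    Applying [phi] to the matrix form of the comodule condition and taking coefficients of [eps]
    gives the identity. *)
Lemma comodule_end_deriv (O : superAlgebra k) (u : scalext V O -> scalext V O)
    (f : 'End(tpower V r)) b c (i l : mindex) :
  represents_GL u -> comodule_end u f ->
  \sum_(j : mindex) f (tbasis j) i * deriv_coef b c j l =
  \sum_(j : mindex) f (tbasis l) j * deriv_coef b c i j.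
Proof.
move=> [_ _ univ] fu.
have [phi [_ phiE _]] :=
  univ _ _ (@dual_supercommutative _ _) (elementary_GL b c).
have X i' j' : (phi (coaction_coef u i' j') : dual k).2 = deriv_coef b c i' j'.
  rewrite (rmorphM phi) rmorph_sign (rmorph_prod phi).
  have E a : phi (taut_coaction u (hvec (j' a)) (i' a)) =
      ((i' a == j' a)%:R, ((i' a == b) && (j' a == c))%:R) :> dual k.
    by rewrite -elementary_hvec phiE ffunE.
  rewrite (eq_bigr _ (fun a _ => E a)) /deriv_coef.
  rewrite -signr_odd -[in RHS]signr_odd.
  have -> z : ((-1) ^+ odd (coaction_sign i' j') * z : dual k).2 =
      (-1) ^+ odd (coaction_sign i' j') * z.2.
    by case: odd; rewrite ?expr0 ?expr1 ?mul1r // !mulN1r.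
  congr (_ * _); rewrite dual_prod2; apply: eq_bigr => a _ /=; congr (_ * _).
have /ffunP/(_ i) := fu (tbasis l); rewrite !ffunE.
move=> /(congr1 (fun x => (phi x : dual k).2)).
have Z (I : finType) (y : I -> k) (z : I -> O) :
    (phi (\sum_j y j *: z j) : dual k).2 = \sum_j y j * (phi (z j) : dual k).2.
  rewrite linear_sum /=.
  rewrite (big_morph (fun x : dual k => x.2) (id1 := 0) (op1 := +%R)) //.
  by apply: eq_bigr => j _; rewrite linearZ.
rewrite !Z; under eq_bigr do rewrite tpower_coaction_tbasis X.
by under [RHS]eq_bigr do rewrite X.
Qed.

End Commutation.

(** * The action of the symmetric group *)

Section SymmetricGroupAction.
Variables (k : fieldType) (V : superSpace k) (r : nat).
Notation mindex := (mindex V r).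

(** As [s] moves the factor at a to [s a], it sends the basis tensor of [i] to that of
    [mperm s^-1 i], up to sign. *)
Definition mperm (s : 'S_r) (i : mindex) : mindex := [ffun a => i (s a)].

Lemma mpermM s t i : mperm t (mperm s i) = mperm (t * s)%g i.
Proof. by apply/ffunP => a; rewrite !ffunE permM. Qed.

Lemma mperm1 i : mperm 1%g i = i.
Proof. by apply/ffunP => a; rewrite ffunE perm1. Qed.

Lemma mpermKV s : cancel (mperm s^-1) (mperm s).
Proof. by move=> i; rewrite mpermM mulgV mperm1. Qed.

Lemma mpermK s : cancel (mperm s) (mperm s^-1).
Proof. by move=> i; rewrite mpermM mulVg mperm1. Qed.

Notation crossings s i := (odd_crossings s (fun a => hpar (i a))).

Lemma eq_crossings s (p q : 'I_r -> bool) :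
  p =1 q -> odd_crossings s p = odd_crossings s q.
Proof.
by move=> pq; do 2!apply: eq_bigr => ? _; rewrite !pq.
Qed.

Lemma perm_actE s (t : tpower V r) i :
  perm_act s t i = (-1) ^+ crossings s (mperm s i) * t (mperm s i).
Proof.
rewrite perm_act_coef; congr (_ ^+ _ * _).
by apply: eq_crossings => a; rewrite ffunE.
Qed.

Lemma perm_act1 : perm_act (1%g : 'S_r) =1 (id : tpower V r -> tpower V r).
Proof.
move=> t; apply/ffunP => i.
by rewrite perm_actE -signr_odd odd_crossings1 mul1r mperm1.
Qed.

Lemma perm_actM (s t : 'S_r) (x : tpower V r) :
  perm_act s (perm_act t x) = perm_act (t * s)%g x.
Proof.
apply/ffunP => i; rewrite !perm_actE mpermM mulrA; congr (_ * _).
rewrite -[RHS]signr_odd odd_crossingsM signr_addb !signr_odd mulrC.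
congr (_ * _ ^+ _); apply: eq_crossings => a.
by rewrite !ffunE permM permKV.
Qed.

(** * Compatibility of the permutations with the coaction *)

Section Coaction.
Variables (O : superAlgebra k) (u : scalext V O -> scalext V O).
Hypotheses (OC : supercommutative O) (uGL : in_GL u).

Lemma taut_coaction_part (i j : 'I_(hdim V)) :
  sa_part (hpar j (+) hpar i) (taut_coaction u (hvec j) i).
Proof.
case: uGL => _ _ uP _; apply: uP => {}i; rewrite ffunE coord_hvec.
have [->|_] := eqVneq i j; last by rewrite scale0r; apply: sa_part0.
by rewrite addbb scale1r; apply: sa_part1.
Qed.

(** Only pairs inverted by [s] contribute. With i, j the parities at a and i', j' those at b, such a
    pair changes the sign exponent by (i + j) i' + (i' + j') i, which is (j + i)(j' + i') + i i' + j
    j' mod 2. *)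
Lemma odd_coaction_sign_mperm s (i j : mindex) :
  odd (coaction_sign (mperm s^-1 i) (mperm s^-1 j)) =
  odd (coaction_sign i j) (+)
  (odd (odd_crossings s (fun a => hpar (j a) (+) hpar (i a))) (+)
   (odd (crossings s i) (+) odd (crossings s j))).
Proof.
have signE i' j' : odd (coaction_sign i' j') =
    pairs_sum (fun a b : 'I_r => (hpar (i' a) (+) hpar (j' a)) && hpar (i' b)).
  by rewrite odd_pairs; apply: eq_pairs_sum => a b _; rewrite oddb.
rewrite !odd_crossingsE !signE -!pairs_sumD.
pose F a b := (hpar (i a) (+) hpar (j a)) && hpar (i b).
transitivity (pairs_sum (fun a b => F ((s^-1)%g a) ((s^-1)%g b))).
  by apply: eq_pairs_sum => a b _; rewrite !ffunE.
rewrite pairs_reindex invgK; apply: eq_pairs_sum => a b ab.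
rewrite /F; have : (s b < s a)%N = ~~ (s a < s b)%N.
  rewrite -leqNgt [RHS]leq_eqVlt; case: eqP => // /val_inj/perm_inj e.
  by rewrite e ltnn in ab.
move=> ->; case: (_ < _)%N; case: (hpar (i a)); case: (hpar (i b));
  by case: (hpar (j a)); case: (hpar (j b)).
Qed.

(** Reordering the factors in [O] cancels one crossing term of [odd_coaction_sign_mperm]; what
    remains are the signs with which [s] acts on the basis tensors of [i] and [j]. *)
Lemma coaction_coef_mperm s (i j : mindex) :
  coaction_coef u (mperm s^-1 i) (mperm s^-1 j) =
  (-1) ^+ (crossings s i + crossings s j) * coaction_coef u i j.
Proof.
rewrite /coaction_coef.
have -> : \prod_(a < r) taut_coaction u (hvec (mperm s^-1 j a)) (mperm s^-1 i a)
   = \prod_(a < r) taut_coaction u (hvec (j ((s^-1)%g a))) (i ((s^-1)%g a)).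
  by apply: eq_bigr => a _; rewrite !ffunE.
rewrite (supercommutative_prod_perm s OC
  (q := fun a => hpar (j a) (+) hpar (i a))
  (y := fun a => taut_coaction u (hvec (j a)) (i a))); last first.
  by move=> a; apply: taut_coaction_part.
rewrite !mulrA -!exprD -signr_odd -[in RHS]signr_odd !oddD.
rewrite odd_coaction_sign_mperm; congr (_ ^+ _ * _); congr nat_of_bool.
by case: odd; case: odd; case: odd; case: odd.
Qed.

Lemma comodule_end_perm s :
  comodule_end (r := r) u (linfun (perm_act (V := V) s)).
Proof.
move=> t; apply/ffunP => i; rewrite !ffunE lfunE /=.
(* The matrix of [s] is monomial: row [i] has its only nonzero entry in column [mperm s i]. *)
rewrite (bigD1 (mperm s i)) //= [X in _ + X]big1 ?addr0; last first.
  move=> j ji; rewrite lfunE /= perm_actE tbasisE eq_sym (negbTE ji).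
  by rewrite mulr0 scale0r.
rewrite lfunE /= perm_actE tbasisE eqxx mulr1 ffunE scaler_sumr.
rewrite [RHS](reindex_inj (can_inj (mpermKV s))); apply: eq_bigr => j _ /=.
rewrite perm_actE mpermKV -/(coaction_coef u i _) -/(coaction_coef u _ j).
have -> : coaction_coef u i (mperm s^-1 j) =
    (-1) ^+ (crossings s (mperm s i) + crossings s j) *
      coaction_coef u (mperm s i) j.
  by rewrite -{1}(mpermK s i) coaction_coef_mperm.
rewrite [LHS]scalerA ![_ * t j]mulrC -!scalerA; congr (_ *: _).
have Z n (z : O) : (-1) ^+ n *: z = (-1) ^+ n * z.
  rewrite -!(signr_odd _ n); case: odd; rewrite ?expr0 ?expr1 ?scale1r ?mul1r //.
  by rewrite scaleN1r mulN1r.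
by rewrite !Z mulrA -exprD addnC -addnA addnn -[in RHS]signr_odd oddD odd_double
  addbF signr_odd.
Qed.

Lemma comodule_end_linear a f g :
  comodule_end (r := r) u f -> comodule_end (r := r) u g ->
  comodule_end (r := r) u (a *: f + g).
Proof.
have E (t t' : tpower V r) j : (a *: t + t') j = a * t j + t' j.
  by rewrite !ffunE.
move=> fu gu t; apply/ffunP => i.
have /ffunP/(_ i) := fu t; have /ffunP/(_ i) := gu t.
rewrite 4!ffunE => Hg Hf.
have -> : tpower_coaction u ((a *: f + g) t) i =
    a *: tpower_coaction u (f t) i + tpower_coaction u (g t) i.
  rewrite add_lfunE scale_lfunE !(ffunE _ i) scaler_sumr -big_split /=.
  by apply: eq_bigr => j _; rewrite E scalerDl -scalerA.
rewrite !(ffunE _ i) -Hg -Hf scaler_sumr -big_split /=.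
apply: eq_bigr => j _.
by rewrite add_lfunE scale_lfunE E scalerDl -scalerA.
Qed.

Lemma comodule_end_symalg x : comodule_end (r := r) u (symalg_act V x).
Proof.
rewrite /symalg_act; elim: (index_enum _) => [|s l IH].
  rewrite big_nil => t; apply/ffunP => i; rewrite !ffunE.
  by rewrite !big1 // => j _; rewrite zero_lfunE ffunE scale0r.
by rewrite big_cons; apply: comodule_end_linear => //; apply: comodule_end_perm.
Qed.

End Coaction.

(** * The action of the group algebra *)

Lemma symalg_actE x (t : tpower V r) i :
  symalg_act V x t i = \sum_s x s * perm_act s t i.
Proof.
rewrite sum_lfunE sum_ffunE; apply: eq_bigr => s _.
by rewrite scale_lfunE lfunE ffunE.
Qed.

(** Distinct factors have distinct permutations, and even ones produce no signs. Thus [x] can be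
    read off from its effect on a single tensor. *)
Lemma symalg_act_tbasis x (e : mindex) s :
  injective e -> (forall a, hpar (e a) = false) ->
  symalg_act V x (tbasis e) (mperm s^-1 e) = x s.
Proof.
move=> e_inj e0; rewrite symalg_actE (bigD1 s) //= big1 ?addr0; last first.
  move=> t ts; rewrite perm_actE tbasisE mpermM.
  case: eqP => [/ffunP te|_]; last by rewrite !mulr0.
  case/eqP: ts; apply/permP => a.
  have := te a; rewrite ffunE permM => /e_inj h.
  by rewrite -[in RHS]h permKV.
rewrite perm_actE mpermKV tbasisE eqxx mulr1.
rewrite /odd_crossings big1 ?expr0 ?mulr1 // => a _; rewrite big1 // => b _.
by rewrite !e0.
Qed.

Lemma symalg_act_linear :
  linear (symalg_act V : symalg k r -> 'End(tpower V r)).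
Proof.
move=> a x y; rewrite /symalg_act scaler_sumr -big_split /=.
by apply: eq_bigr => s _; rewrite !ffunE scalerDl -scalerA.
Qed.

Lemma symalg_act1 :
  symalg_act V (symalg_one k r) = \1%VF :> 'End(tpower V r).
Proof.
apply/lfunP => t; rewrite id_lfunE; apply/ffunP => i.
rewrite symalg_actE (bigD1 1%g) //= big1 ?addr0 => [|s s1].
  by rewrite ffunE eqxx mul1r perm_act1.
by rewrite ffunE (negbTE s1) mul0r.
Qed.

Lemma symalg_actM (x y : symalg k r) :
  symalg_act V (symalg_mul x y) = (symalg_act V x \o symalg_act V y)%VF.
Proof.
apply/lfunP => t; rewrite comp_lfunE; apply/ffunP => i.
rewrite !symalg_actE.
under eq_bigr do rewrite ffunE mulr_suml.
rewrite exchange_big; apply: eq_bigr => s _ /=.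
under eq_bigr do rewrite mulr_suml.
rewrite (exchange_big_dep predT) //=.
have -> : perm_act s (symalg_act V y t) = \sum_t' y t' *: perm_act (t' * s)%g t.
  rewrite sum_lfunE linear_sum; apply: eq_bigr => t' _.
  by rewrite scale_lfunE lfunE linearZ /= perm_actM.
rewrite sum_ffunE mulr_sumr; apply: eq_bigr => t' _.
rewrite (big_pred1 (t' * s)%g) => [|w]; first by rewrite ffunE [RHS]mulrA.
by rewrite eq_sym.
Qed.

End SymmetricGroupAction.

(** * Endomorphisms commuting with the operators E_bc *)

Section DerivationCentralizer.
Variables (k : fieldType) (V : superSpace k) (r : nat).
Notation mindex := (mindex V r).

(** When E_bc hits the factor of [j] at position [a], the resulting basis tensor is that of [i], up
    to sign. *)
Definition moves_at (b c : 'I_(hdim V)) (i j : mindex) (a : 'I_r) :=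
  [&& i a == b, j a == c & [forall (a' | a' != a), i a' == j a']].

Lemma deriv_coefE b c (i j : mindex) :
  deriv_coef b c i j =
  (-1) ^+ coaction_sign i j * \sum_(a < r) (moves_at b c i j a)%:R.
Proof.
congr (_ * _); apply: eq_bigr => a _.
rewrite /moves_at andbA; case: andb; rewrite ?mul0r // mul1r /=.
case: forall_inP => [ij|nij].
  by rewrite big1 // => a' /ij ->.
have [a' a'a ne] : exists2 a', a' != a & i a' != j a'.
  apply/exists_inP; rewrite -negb_forall_in; exact/forall_inP.
by rewrite (bigD1 a') //= (negbTE ne) mul0r.
Qed.

Lemma deriv_coef_eq0 b c (i j : mindex) :
  (forall a, ~~ moves_at b c i j a) -> deriv_coef b c i j = 0.
Proof.
move=> ij; rewrite deriv_coefE big1 ?mulr0 // => a _.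
by rewrite (negbTE (ij a)).
Qed.

(** A single hit leaves a sign. Several hits would add up to an integer that could vanish in [k]. *)
Lemma deriv_coef_neq0 b c (i j : mindex) a :
  moves_at b c i j a -> (forall a', a' != a -> ~~ moves_at b c i j a') ->
  deriv_coef b c i j != 0.
Proof.
move=> ija ij; rewrite deriv_coefE (bigD1 a) //= ija big1 ?addr0 ?mulr1.
  by rewrite signr_eq0.
by move=> a' /ij/negbTE ->.
Qed.

Variable f : 'End(tpower V r).
Hypothesis f_deriv : forall b c (i l : mindex),
  \sum_(j : mindex) f (tbasis j) i * deriv_coef b c j l =
  \sum_(j : mindex) f (tbasis l) j * deriv_coef b c i j.
Variable e : mindex.
Hypothesis e_inj : injective e.

(** A weight argument: for each factor b of [e], E_bb fixes the tensor of [e], as b occurs once,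
    while row [i] of E_bb is zero unless b occurs in [i]. So [i] contains all [r] distinct factors
    of [e]. *)
Lemma deriv_commute_support i :
  f (tbasis e) i != 0 -> exists s : 'S_r, i = mperm s^-1 e.
Proof.
move=> fei.
have hit b : exists a, i a = e b.
  apply/'exists_eqP; apply: contraNT fei; rewrite negb_exists => /forallP ieb.
  have := f_deriv (e b) (e b) i e; rewrite [RHS]big1; last first.
    move=> j _; rewrite deriv_coef_eq0 ?mulr0 // => a.
    by rewrite /moves_at (negbTE (ieb a)).
  rewrite (bigD1 e) //= [X in _ + X]big1 ?addr0; last first.
    move=> j je; rewrite deriv_coef_eq0 ?mulr0 // => a.
    apply: contra je => /and3P [/eqP ja /eqP ea /forall_inP ja'].
    apply/eqP/ffunP => a'; have [->|/ja'/eqP//] := eqVneq a' a.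
    by rewrite ja ea.
  move=> /eqP; rewrite mulf_eq0 => /orP [//|] /idPn [].
  apply: (deriv_coef_neq0 (a := b)).
    by rewrite /moves_at !eqxx; apply/forall_inP.
  by move=> a' a'b; rewrite /moves_at (inj_eq e_inj) (negbTE a'b).
have [g ig] := fin_all_exists hit.
have g_inj : injective g.
  by move=> a b ab; apply: e_inj; rewrite -!ig ab.
exists (perm g_inj); rewrite -[LHS](mpermK (perm g_inj)); congr (mperm _ _).
by apply/ffunP => a; rewrite ffunE permE.
Qed.

Lemma deriv_commute_eq0 : f (tbasis e) = 0 -> f = 0.
Proof.
move=> fe.
(* Induction on the number [n] of leading positions in which [l] is arbitrary. *)
have fl n (l : mindex) : (forall a : 'I_r, n <= a -> l a = e a)%N ->
    f (tbasis l) = 0.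
  elim: n l => [|n IH] l le.
    by rewrite (_ : l = e) //; apply/ffunP => a; apply: le.
  have [nr|rn] := ltnP n r; last first.
    by apply: IH => a na; have := leq_trans rn na; rewrite leqNgt ltn_ord.
  pose c := Ordinal nr.
  have [lc|lc] := eqVneq (l c) (e c).
    apply: IH => a; rewrite leq_eqVlt => /orP [/eqP na|/le//].
    by rewrite (_ : a = c) //; apply: val_inj.
  (* Position [c] is reset to the factor of [e], so [f] kills [l'] by induction; the operator E with
     indices [l c], [e c] leads from [l'] back to [l]. *)
  pose l' : mindex := [ffun a => if a == c then e c else l a].
  have l'E a : a != c -> l' a = l a by rewrite ffunE => /negbTE ->.
  have l'c : l' c = e c by rewrite ffunE eqxx.
  have le' (a : 'I_r) : (n <= a)%N -> l' a = e a.
    rewrite leq_eqVlt => /orP [/eqP na|na].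
      by rewrite (_ : a = c) //; apply: val_inj.
    by rewrite l'E ?le //; apply: contraTneq na => ->; rewrite ltnn.
  apply/ffunP => i; rewrite [RHS]ffunE.
  have := f_deriv (l c) (e c) i l'; rewrite [RHS]big1; last first.
    by move=> j _; rewrite (IH _ le') ffunE mul0r.
  rewrite (bigD1 l) //= [X in _ + X]big1 ?addr0; last first.
    move=> j jl; have [->|fj] := eqVneq (f (tbasis j)) 0.
      by rewrite ffunE mul0r.
    rewrite deriv_coef_eq0 ?mulr0 // => a; apply: contra fj.
    move=> /and3P [/eqP ja /eqP l'a /forall_inP jl'].
    (* A hit at [c] yields [l] itself. A hit elsewhere must come before [c], as the factors of [e]
       are distinct, so it leaves a tensor covered by induction. *)
    have [ac|ac] := eqVneq a c.
      case/eqP: jl; apply/ffunP => a'; have [->|a'c] := eqVneq a' c.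
        by rewrite -ac ja ac.
      by rewrite -l'E //; apply/eqP/jl'; rewrite ac.
    apply/eqP/IH => a' na'; rewrite -le' //; apply/eqP/jl'.
    apply: contra_neq ac => a'a; apply: e_inj.
    by rewrite -l'a -le' // -a'a.
  move=> /eqP; rewrite mulf_eq0 => /orP [/eqP //|] /idPn [].
  apply: (deriv_coef_neq0 (a := c)).
    rewrite /moves_at l'c !eqxx; apply/forall_inP => a' a'c.
    by rewrite l'E.
  move=> a ac; apply/negP => /and3P [_ _ /forall_inP/(_ c)].
  by rewrite l'c (negbTE lc) eq_sym ac => /(_ isT).
apply/lfunP => t; rewrite zero_lfunE (tpower_sum t) linear_sum big1 // => j _.
rewrite linearZ /= (fl r) ?scaler0 // => a.
by rewrite leqNgt ltn_ord.
Qed.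

End DerivationCentralizer.

Theorem proposition6p2p3 (k : closedFieldType) (p : nat)
    (char_k : has_characteristic k p) (r m n : nat) (V : superSpace k)
    (dimV : sdim V = (m, n)) (p_notin : ~~ (2 <= p <= r)%N)
    (r_le : (r <= minn m n)%N)
    (O : superAlgebra k) (u : scalext V O -> scalext V O)
    (OP : represents_GL u) :
  [/\ linear (symalg_act V : symalg k r -> 'End(tpower V r)),
      symalg_act V (symalg_one k r) = \1%VF,
      forall x y : symalg k r,
        symalg_act V (symalg_mul x y) =
          (symalg_act V x \o symalg_act V y)%VF,
      injective (symalg_act V : symalg k r -> 'End(tpower V r))
    & forall f : 'End(tpower V r),
        comodule_end u f <-> exists x : symalg k r, symalg_act V x = f].
Proof.
have r_dim0 : (r <= \dim (ss_part V false))%N.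
  by case: dimV => -> _; apply: leq_trans r_le (geq_minl m n).
have r_dim : (r <= hdim V)%N := leq_trans r_dim0 (leq_addr _ _).
(* The first [r] vectors of the homogeneous basis, in which the even ones come first. *)
pose e : mindex V r := [ffun a => widen_ord r_dim a].
have e_inj : injective e.
  by move=> a b; rewrite !ffunE => /(congr1 val)/= /val_inj.
have e0 a : hpar (e a) = false.
  by rewrite ffunE /hpar leqNgt (leq_trans (ltn_ord a)).
have [OC uGL _] := OP.
split; [exact: symalg_act_linear | exact: symalg_act1 | exact: symalg_actM | |].
  move=> x y xy; apply/ffunP => s.
  by rewrite -(symalg_act_tbasis x s e_inj e0) xy symalg_act_tbasis.
move=> f; split=> [fu|[x <-]]; last exact: comodule_end_symalg.
(* By [symalg_act_tbasis], this [x] agrees with [f] on the tensor of [e] in all coordinates that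
   permute [e]; [deriv_commute_support] handles the others. *)
pose x : symalg k r := [ffun s => f (tbasis e) (mperm s^-1 e)].
pose h := (-1) *: symalg_act V x + f.
have hu : comodule_end u h.
  by apply: comodule_end_linear => //; apply: comodule_end_symalg.
have h_deriv b c i l := comodule_end_deriv b c i l OP hu.
have h0 : h = 0.
  apply: (deriv_commute_eq0 h_deriv e_inj); apply/ffunP => i.
  apply/eqP; rewrite [X in _ == X]ffunE; apply/negP => /negP hi.
  have [s iE] := deriv_commute_support h_deriv e_inj hi.
  move: hi; rewrite iE /h add_lfunE scale_lfunE !ffunE symalg_act_tbasis //.
  by rewrite ffunE scaleN1r addNr eqxx.
exists x; apply/eqP; rewrite eq_sym -subr_eq0 addrC -scaleN1r.
exact/eqP.
Qed.
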